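(* Let $f\in K[X]$ be such that $\mathcal Z(f)\cap\operatorname{Lim}\mathcal C\ne\emptyset$. Then $$h_K(X:f)=\#\bigl(\mathcal Z(f)\cap\operatorname{Lim}\mathcal C\bigr)=j_{w^*}(f).$$ Moreover, $h_K(X:Q)$ divides $h_K(X:f)$.
   Context: Setting: $(K,v)$ is a valued field with $\operatorname{char}K=p$ an odd prime, $X$ is transcendental over $K$, and $(K(X)|K,w)$ is an immediate extension of valued fields ($wK(X)=vK$, $K(X)w=Kv$). Fix an extension of $w$ to $\overline{K(X)}$, again denoted $w$; its restriction to $\overline K$ is denoted $v$. A sequence $\{z_\nu\}_{\nu<\lambda}\subset K$ ($\lambda$ a limit ordinal) is pseudo-convergent if $v(z_\nu-z_\mu)<v(z_\mu-z_\rho)$ for all $\nu<\mu<\rho<\lambda$. Put $\gamma_\nu:=v(z_\nu-z_{\nu+1})$; $Y\in\overline{K(X)}$ is a limit if $w(Y-z_\nu)=\gamma_\nu$ for all $\nu<\lambda$. Fix a pseudo-convergent sequence $\mathcal C=\{z_\nu\}_{\nu<\lambda}\subset K$ without a limit in $K$ and with $X$ as a limit; $\operatorname{Lim}\mathcal C$ is the set of all limits of $\mathcal C$ in $\overline{K(X)}$. Assume $\mathcal C$ is of algebraic type, i.e. there is a polynomial $q\in K[X]$ for which $\{vq(z_\nu)\}$ is not ultimately constant (equivalently, ultimately strictly increasing); $Q$ is an associated minimal polynomial to $\mathcal C$, i.e. a monic polynomial over $K$ of least degree with this property. $\mathcal Z(f)$ is the multiset of roots of $f$ in $\overline K$ (nonzero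 $f$), and cardinalities $\#$ count multiplicity. Relative approximation degree: if there exist $\nu_0<\lambda$, a positive integer $h$ and $\beta\in vK$ with $w(f(X)-f(z_\nu))=\beta+h\,w(X-z_\nu)$ for all $\nu_0<\nu<\lambda$, then $h_K(X:f):=h$. It is known to exist whenever $\{vf(z_\nu)\}$ is ultimately strictly increasing, equivalently whenever $\mathcal Z(f)\cap\operatorname{Lim}\mathcal C\neq\emptyset$. The valuation $w^*$ and its $j$-invariant: let $\gamma:=\sup\{\gamma_\nu\}_{\nu<\lambda}$ in the Dedekind–MacNeille completion of $vK$, and choose $a\in\mathcal Z(Q)\cap\operatorname{Lim}\mathcal C$ (this intersection is nonempty). $w^*:=v_{a,\gamma}$ is the valuation $w^*\bigl(\sum_i c_i(X-a)^i\bigr)=\min_i\{vc_i+i\gamma\}$, and $j_{w^*}(f):=\#\{z\in\mathcal Z(f)\mid v(a-z)\ge\gamma\}$, where for $\delta\in v\overline K\cup\{\infty\}$ the relation $\delta\ge\gamma$ means $\delta\ge\gamma_\nu$ for all $\nu<\lambda$. *)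

(* Defs.v *)
From HB Require Import structures.
From mathcomp Require Import all_boot all_order all_algebra.
From mathcomp Require Import boolp classical_sets wochoice.

Set Implicit Arguments.
Unset Strict Implicit.
Unset Printing Implicit Defensive.

Import Order.TTheory GRing.Theory Num.Theory.

Local Open Scope classical_set_scope.
Local Open Scope ring_scope.

(* Value groups are arbitrary totally ordered abelian groups, of any rank;    *)
(* porderZmodType alone does not relate the order to the addition.            *)
Record ordered_group (G : porderZmodType) : Prop := OrderedGroup {
  og_total : forall a b : G, (a <= b) || (b <= a);
  og_leD2l : forall a b c : G, b <= c -> a + b <= a + c
}.

(* Values live in option G, where None stands for the value oo of 0.          *)
Section Values.
Variable G : porderZmodType.
Implicit Types a b : option G.

Definition vle a b : bool :=
  match a, b with
  | _, None => true
  | None, Some _ => false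
  | Some g, Some h => g <= h
  end.

Definition vlt a b : bool := ~~ vle b a.

Definition vmin a b := if vle a b then a else b.

Definition vadd a b : option G :=
  match a, b with
  | Some g, Some h => Some (g + h)
  | _, _ => None
  end.

End Values.

Record is_valuation (L : fieldType) (G : porderZmodType)
    (w : L -> option G) : Prop := IsValuation {
  valuation_eqoo : forall x, w x = None <-> x = 0;
  valuationM : forall x y, w (x * y) = vadd (w x) (w y);
  valuationD : forall x y, vle (vmin (w x) (w y)) (w (x + y))
}.

(* A limit ordinal, presented as a nonempty well-ordered type without         *)
(* greatest element.                                                          *)
Definition limit_ordinal d (I : orderType d) : Prop :=
  [/\ inhabited I,
      well_order (fun i j : I => (i <= j)%O)
    & forall i : I, exists j : I, (i < j)%O].

(* When limit_ordinal I holds the set below is a singleton.                   *)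
Definition osucc d (I : orderType d) (i : I) : I :=
  xget i [set j | (i < j)%O /\ forall k : I, (i < k)%O -> (j <= k)%O].

Local Notation "p %:F" := (FracField.tofrac p).

(* L is meant to be an algebraic closure of K(X) via iota. There is a single  *)
(* valuation w, on L; the valuations of K(X), of K and of the algebraic       *)
(* closure of K are its restrictions.                                         *)
Section Setting.
Variables (K : fieldType) (L : closedFieldType) (G : porderZmodType).
Variable iota : {rmorphism {fraction {poly K}} -> L}.

Definition cst (c : K) : L := iota (c%:P)%:F.

HB.instance Definition _ :=
  GRing.RMorphism.copy cst (iota \o (@FracField.tofrac {poly K}) \o polyC).

Definition xvar : L := iota ('X)%:F.

(* The roots of f in L with multiplicity; for f != 0 they all lie in the      *)
(* algebraic closure of K in L. For f = 0 the value is meaningless.           *)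
Definition Zroots (f : {poly K}) : seq L :=
  sval (closed_field_poly_normal (map_poly cst f)).

Variable w : L -> option G.

(* The value group of a field F embedded in L by phi.                         *)
Definition value_group (F : fieldType) (phi : F -> L) : set G :=
  [set g | exists x : F, w (phi x) = Some g].

(* The residue field of F, as a subset of the residue field of L; the residue *)
(* of y is its coset modulo the maximal ideal.                                *)
Definition residue (y : L) : set L := [set y' | vlt (Some 0) (w (y' - y))].

Definition residue_field (F : fieldType) (phi : F -> L) : set (set L) :=
  [set C | exists2 x : F, vle (Some 0) (w (phi x)) & C = residue (phi x)].

Definition immediate : Prop :=
  value_group iota = value_group cst /\ residue_field iota = residue_field cst.

Variables (d : Order.disp_t) (I : orderType d) (z : I -> K).

Definition pseudo_convergent : Prop :=
  forall i j k : I, (i < j)%O -> (j < k)%O ->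
    vlt (w (cst (z i - z j))) (w (cst (z j - z k))).

Definition gam (i : I) : option G := w (cst (z i - z (osucc i))).

Definition Lim : set L := [set y | forall i : I, w (y - cst (z i)) = gam i].

Definition ultimately_constant (q : {poly K}) : Prop :=
  exists (i0 : I) (c : option G), forall i : I, (i0 < i)%O ->
    w (cst q.[z i]) = c.

Definition algebraic_type : Prop :=
  exists q : {poly K}, ~ ultimately_constant q.

Definition minimal_polynomial (Q : {poly K}) : Prop :=
  [/\ Q \is monic, ~ ultimately_constant Q
    & forall q : {poly K}, ~ ultimately_constant q -> (size Q <= size q)%N].

Definition is_approx_degree (f : {poly K}) (h : nat) : Prop :=
  (0 < h)%N /\
  exists (i0 : I) (b : G), value_group cst b /\
    forall i : I, (i0 < i)%O ->
      w (iota f%:F - cst f.[z i]) =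
      omap (fun g => b + g *+ h) (w (xvar - cst (z i))).

(* The relative approximation degree h_K(X : f). The default value 0, which   *)
(* never satisfies is_approx_degree, means that it does not exist.            *)
Definition approx_degree (f : {poly K}) : nat :=
  xget 0%N [set h | is_approx_degree f h].

(* #(Z(f) :&: Lim), counted with multiplicity.                                *)
Definition count_lim (f : {poly K}) : nat :=
  count (fun y => `[< Lim y >]) (Zroots f).

(* The relation e >= gamma, for gamma the supremum of the gam i in the        *)
(* Dedekind-MacNeille completion of the value group of K.                     *)
Definition ge_gamma (e : option G) : Prop := forall i : I, vle (gam i) e.

(* The j-invariant of w^* = v_{a, gamma}. It is a function of the pair        *)
(* (a, gamma) defining w^*.                                                   *)
Definition j_invariant (a : L) (f : {poly K}) : nat :=
  count (fun y => `[< ge_gamma (w (a - y)) >]) (Zroots f).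

End Setting.

(* Main.v *)
Require Import Defs.
From HB Require Import structures.
From mathcomp Require Import all_boot all_order all_algebra.
From mathcomp Require Import boolp classical_sets.

(** Factor f over L. A linear factor [z i - y] has value [gam i] when the root
    y is a limit, and eventually constant value otherwise; hence [v (f (z i))]
    is eventually [b + m gam i], with m the number of limit roots of f, and m is
    determined by these values since [gam] is strictly increasing. The same
    estimate at X gives [w (f X) > v (f (z i))] when [0 < m], so
    [w (f X - f (z i)) = v (f (z i))] and m is the approximation degree.
    For the divisibility, divide f = q Q + r: the values of r are eventually
    constant by minimality of Q, so m is either 0 or the exponent of q Q, which
    is the sum of those of q and Q; conclude by induction on the degree. *)

Set Implicit Arguments.
Unset Strict Implicit.
Unset Printing Implicit Defensive.

Local Open Scope classical_set_scope.
Local Open Scope ring_scope.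

Import Order.TTheory GRing.Theory.

(** * Totally ordered abelian groups and their extension by an infinite value *)

Section OrderedGroup.
Variables (G : porderZmodType) (hG : ordered_group G).
Implicit Types a b c e : G.
Implicit Types s t : option G.

Lemma og_ltD2l a b c : b < c -> a + b < a + c.
Proof.
rewrite !lt_neqAle => /andP[bc /(og_leD2l hG a) ->].
by rewrite andbT; apply: contra bc => /eqP /addrI ->.
Qed.

Lemma og_leD a b c e : a <= b -> c <= e -> a + c <= b + e.
Proof.
move=> ab /(og_leD2l hG a) /le_trans -> //.
by rewrite ![_ + e]addrC; exact: og_leD2l hG _ _ _ ab.
Qed.

Lemma og_ltMn a b n : a < b -> (0 < n)%N -> a *+ n < b *+ n.
Proof.
move=> ab; case: n => // n _; elim: n => // n IHn.
rewrite !(mulrS _ n.+1).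
exact: lt_le_trans (og_ltD2l a IHn) (og_leD (ltW ab) (lexx _)).
Qed.

Lemma og_leNgt a b : (a <= b) = ~~ (b < a).
Proof.
apply/idP/idP => [/le_gtF -> //|]; rewrite lt_neqAle negb_and negbK.
by case/orP => [/eqP -> //|]; case/orP: (og_total hG a b) => // ->.
Qed.

Lemma vle_total s t : vle s t || vle t s.
Proof. by case: s t => [a|] [b|] //=; exact: og_total hG a b. Qed.

Lemma vlt_vle s t : vlt s t -> vle s t.
Proof. by move=> /negPf st; move: (vle_total s t); rewrite st orbF. Qed.

Lemma vle_trans t s r : vle s t -> vle t r -> vle s r.
Proof. by case: s t r => [a|] [b|] [c|] //=; exact: le_trans. Qed.

Lemma vle_anti s t : vle s t -> vle t s -> s = t.
Proof.
by case: s t => [a|] [b|] //= ab ba; rewrite (@le_anti _ _ a b) ?ab.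
Qed.

Lemma vle_add s t s' t' : vle s t -> vle s' t' -> vle (vadd s s') (vadd t t').
Proof. by case: s t s' t' => [a|] [b|] [c|] [e|] //=; exact: og_leD. Qed.

Lemma vlt_SomeE a b : vlt (Some a) (Some b) = (a < b).
Proof. by rewrite /vlt /= og_leNgt negbK. Qed.

(** * Ultrametric calculus for a valuation on a field *)

Section Valuation.
Variables (L : fieldType) (w : L -> option G) (hw : is_valuation w).
Implicit Types x y : L.

Lemma val_neq0 x : x != 0 -> exists a, w x = Some a.
Proof.
move=> x0; case E: (w x) => [a|]; first by exists a.
by move/(valuation_eqoo hw): E x0 => ->; rewrite eqxx.
Qed.

Lemma val1 : w 1 = Some 0.
Proof.
have [a wa] := val_neq0 (oner_neq0 L).
by have:= valuationM hw 1 1; rewrite mulr1 wa /= => -[/eqP];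
  rewrite -subr_eq0 opprD addrA subrr sub0r oppr_eq0 => /eqP ->.
Qed.

Lemma valN x : w (- x) = w x.
Proof.
have wN1 : w (-1) = Some 0.
  have [|a wa] := @val_neq0 (-1); first by rewrite oppr_eq0 oner_neq0.
  have:= valuationM hw (-1) (-1); rewrite mulrNN mulr1 val1 wa /= => -[a2].
  (* Here [a + a = 0], and a total order makes the group torsion-free: [a < 0] or [0 < a] would
     persist after doubling. *)
  congr Some; apply: le_anti.
  rewrite !og_leNgt; apply/andP; split; apply/negP => /og_ltMn/(_ (ltn0Sn 1)).
    by rewrite mul0rn mulr2n -a2 ltxx.
  by rewrite mul0rn mulr2n -a2 ltxx.
by rewrite -mulN1r (valuationM hw) wN1; case: (w x) => //= a; rewrite add0r.
Qed.

Lemma valBC x y : w (x - y) = w (y - x).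
Proof. by rewrite -valN opprB. Qed.

Lemma valX x a n : w x = Some a -> w (x ^+ n) = Some (a *+ n).
Proof.
by move=> wx; elim: n => [|n IHn]; rewrite ?val1 // exprS mulrS (valuationM hw)
  wx IHn.
Qed.

Lemma valD_lt x y : vlt (w x) (w y) -> w (x + y) = w x.
Proof.
move=> xy; apply: vle_anti; last first.
  by have:= valuationD hw x y; rewrite /vmin (vlt_vle xy).
(* The reverse inequality comes from [x = (x + y) - y]: the minimum there cannot be attained at
   [w y], which exceeds [w x]. *)
have := valuationD hw (x + y) (- y); rewrite addrK valN /vmin.
by case: ifP => // _ yx; rewrite /vlt yx in xy.
Qed.

Lemma valB_neq x y : w x <> w y -> w (x - y) = vmin (w x) (w y).
Proof.
move=> xy; rewrite /vmin; case: ifP => [le_xy|/negbT nle_xy].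
  apply: valD_lt; rewrite valN /vlt; apply/negP => le_yx.
  by apply: xy; exact: vle_anti.
by rewrite valBC; apply: valD_lt; rewrite valN.
Qed.

End Valuation.
End OrderedGroup.

(** * Pseudo-convergent sequences and their gauge values *)

Section Theorem3p1.
Variables (K : fieldType) (L : closedFieldType) (G : porderZmodType).
Variables (iota : {rmorphism {fraction {poly K}} -> L}) (w : L -> option G).
Variables (d : Order.disp_t) (I : orderType d) (z : I -> K).
Hypotheses (hG : ordered_group G) (hw : is_valuation w).
Hypotheses (hI : limit_ordinal I) (hpc : pseudo_convergent iota w z).

Local Notation cst := (cst iota).
Local Notation X := (xvar iota).
Local Notation Lim := (Lim iota w z).
Local Notation Zroots := (Zroots iota).
Local Notation count_lim := (count_lim iota w z).

Let lim_dec y : bool := `[< Lim y >].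

Lemma ord_inh : exists i : I, True.
Proof. by case: hI => -[i] _ _; exists i. Qed.

Lemma ord_succ (i : I) : exists j, (i < j)%O.
Proof. by case: hI => _ _; apply. Qed.

(** Well-ordering supplies a least index above [i], so the default of [xget] is never returned. *)
Lemma osuccP (i : I) :
  (i < osucc i)%O /\ forall k, (i < k)%O -> (osucc i <= k)%O.
Proof.
apply: (@xgetPex _ i [set j | (i < j)%O /\ forall k, (i < k)%O -> (j <= k)%O]).
case: hI => _ wo _; have [|j [[ij jmin] _]] := wo [pred j | (i < j)%O].
  by have [j ij] := ord_succ i; exists j.
by exists j; split=> // k ik; exact: jmin.
Qed.

Definition gval (i : I) : G := odflt 0 (gam iota w z i).

(** A value strictly below another one is finite, so the default [0] in [gval] is never reached. *)
Lemma gamE i : gam iota w z i = Some (gval i).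
Proof.
rewrite /gval /gam; have [si _] := osuccP i; have [k sk] := ord_succ (osucc i).
by have:= hpc si sk; case: (w (cst (z i - _))) => //; rewrite /vlt; case: (w _).
Qed.

Lemma LimE y : Lim y <-> forall i, w (y - cst (z i)) = Some (gval i).
Proof. by split=> h i; have:= h i; rewrite gamE. Qed.

(** Passing through the successor s of [i], the term [z s - z j] has larger value than [z i - z s],
    so the value does not depend on [j]. *)
Lemma val_pc i j : (i < j)%O -> w (cst (z j) - cst (z i)) = Some (gval i).
Proof.
move=> ij; have [si smin] := osuccP i; rewrite (valBC hG hw) -gamE /gam.
rewrite -rmorphB; have:= smin _ ij; rewrite le_eqVlt => /orP[/eqP <- //|sj].
rewrite -[in LHS](subrK (z (osucc i)) (z i)) -addrA rmorphD.
by rewrite (valD_lt hG hw) //; exact: hpc.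
Qed.

Lemma gval_lt i j : (i < j)%O -> gval i < gval j.
Proof.
move=> ij; have [k jk] := ord_succ j; have:= hpc ij jk.
rewrite !rmorphB (valBC hG hw (cst (z i))) (valBC hG hw _ (cst (z k))).
by rewrite !val_pc ?vlt_SomeE.
Qed.

(** * Sequences of values eventually affine in [gval], and their exponents *)

Definition eventually_affine (s : I -> option G) (m : nat) : Prop :=
  exists (i0 : I) (b : G), forall i, (i0 < i)%O -> s i = Some (b + gval i *+ m).

(** If [m < n], equating the two formulas makes [gval k *+ (n - m)] constant for large [k], although
    [gval] strictly increases. *)
Lemma eventually_affine_inj s m n :
  eventually_affine s m -> eventually_affine s n -> m = n.
Proof.
wlog: m n / (m <= n)%N => [th|].
  by move=> sm sn; case/orP: (leq_total m n) => /th; [|move=> h; symmetry]; auto.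
rewrite leq_eqVlt => /orP[/eqP //|mn] [i1 [b sb]] [i2 [c sc]].
have [i] := ord_succ (Order.max i1 i2); rewrite gt_max => /andP[i1i i2i].
have [j ij] := ord_succ i; have:= og_ltMn hG (gval_lt ij).
move=> /(_ (n - m)%N); rewrite subn_gt0 => /(_ mn).
have E k : (i <= k)%O -> b = c + gval k *+ (n - m).
  move=> ik; have i1k := lt_le_trans i1i ik; have i2k := lt_le_trans i2i ik.
  have:= sc _ i2k; rewrite sb // => -[] /(canRL (addrK _)) ->.
  by rewrite -addrA -mulrnBr ?(ltnW mn).
have:= E _ (ltW ij); rewrite {1}(E _ (lexx i)) => /addrI ->.
by rewrite ltxx.
Qed.

Lemma eventually_affineD s t m n :
  eventually_affine s m -> eventually_affine t n ->
  eventually_affine (fun i => vadd (s i) (t i)) (m + n).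
Proof.
move=> [i1 [b sb]] [i2 [c tc]]; exists (Order.max i1 i2), (b + c) => i.
by rewrite gt_max => /andP[i1i i2i]; rewrite sb // tc //= mulrnDr addrACA.
Qed.

Lemma eventually_affine_sum (x y : I -> L) m n : (m < n)%N ->
  eventually_affine (w \o x) m -> eventually_affine (w \o y) n ->
  eventually_affine (fun i => w (x i + y i)) m \/
  eventually_affine (fun i => w (x i + y i)) n.
Proof.
move=> mn [i1 [b xb]] [i2 [c yc]].
(* In a group of arbitrary rank the two affine functions need not cross. If they meet at [j], the
   exponent [m] gives the strictly smaller value after [j]; otherwise the exponent [n] always
   does. *)
have [[j bc]|nbc] := pselect (exists j, b <= c + gval j *+ (n - m)).
  left; exists (Order.max j (Order.max i1 i2)), b => i.
  rewrite !gt_max => /and3P[ji i1i i2i].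
  have:= xb _ i1i; have:= yc _ i2i => /= wy wx; rewrite -wx.
  apply: (valD_lt hG hw); rewrite wx wy vlt_SomeE //.
  rewrite -[in ltRHS](subnK (ltnW mn)) mulrnDr addrA ![_ + gval i *+ m]addrC.
  apply: og_ltD2l => //; apply: le_lt_trans bc _; apply: og_ltD2l => //.
  by apply: og_ltMn (gval_lt ji) _; rewrite ?subn_gt0.
right; exists (Order.max i1 i2), c => i; rewrite gt_max => /andP[i1i i2i].
have:= xb _ i1i; have:= yc _ i2i => /= wy wx; rewrite -wy addrC.
apply: (valD_lt hG hw); rewrite wx wy vlt_SomeE //.
rewrite -[in ltLHS](subnK (ltnW mn)) mulrnDr addrA ![_ + gval i *+ m]addrC.
apply: og_ltD2l => //; apply/negPn; rewrite -og_leNgt //.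
by apply/negP => bc; apply: nbc; exists i.
Qed.

(** * Values of polynomials along the sequence and at a limit *)

Lemma val_linear_factor (x y : L) : Lim x ->
  exists (i0 : I) (b : G), forall i, (i0 < i)%O ->
    w (cst (z i) - y) = Some (b + gval i *+ lim_dec y) /\
    vle (w (cst (z i) - y)) (w (x - y)).
Proof.
move=> /LimE xlim; rewrite /lim_dec; case: asboolP => [/LimE ylim|].
  have [i0 _] := ord_inh; exists i0, 0 => i _; rewrite add0r.
  rewrite (valBC hG hw) ylim mulr1n; split=> //.
  have:= valuationD hw (x - cst (z i)) (cst (z i) - y).
  by rewrite addrA subrK (valBC hG hw (cst _)) ylim xlim /vmin /= lexx.
move/LimE/existsNP => [i0 ylim].
(* At [i0] the root [y] violates the limit condition. Both [x] and every later [z i] satisfy it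
   there, so writing [t - y] as a difference of distances to [z i0] gives them the same value. *)
have wB t : w (t - cst (z i0)) = Some (gval i0) ->
    w (t - y) = vmin (Some (gval i0)) (w (y - cst (z i0))).
  move=> tlim; rewrite -tlim -(valB_neq hG hw) ?tlim; last exact/nesym.
  by rewrite opprB addrA subrK.
have [b bE] : exists b, vmin (Some (gval i0)) (w (y - cst (z i0))) = Some b.
  rewrite /vmin; case: (w _) => [e|] /=; last by exists (gval i0).
  by case: ifP; [exists (gval i0)|exists e].
exists i0, b => i i0i; rewrite !wB ?xlim ?val_pc // bE mulr0n addr0.
by split=> /=.
Qed.

Lemma val_prod_factors (x : L) (s : seq L) : Lim x ->
  exists (i0 : I) (b : G), forall i, (i0 < i)%O ->
    w (\prod_(y <- s) (cst (z i) - y)) = Some (b + gval i *+ count lim_dec s) /\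
    vle (w (\prod_(y <- s) (cst (z i) - y))) (w (\prod_(y <- s) (x - y))).
Proof.
move=> xlim; elim: s => [|y s [i1 [b sb]]].
  have [i0 _] := ord_inh; exists i0, 0 => i _.
  by rewrite !big_nil (val1 hw) /= mulr0n addr0.
have [i2 [c yc]] := @val_linear_factor x y xlim.
exists (Order.max i1 i2), (c + b) => i; rewrite gt_max => /andP[i1i i2i].
have [ws les] := sb _ i1i; have [wy ley] := yc _ i2i.
rewrite !big_cons !(valuationM hw); split; last exact: vle_add.
by rewrite ws wy /= mulrnDr addrACA.
Qed.

Lemma Zroots_factor f :
  map_poly cst f = cst (lead_coef f) *: \prod_(y <- Zroots f) ('X - y%:P).
Proof.
by rewrite /Zroots; case: closed_field_poly_normal => s /= {1}->;
  rewrite lead_coef_map.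
Qed.

Lemma horner_factor f x :
  (map_poly cst f).[x] = cst (lead_coef f) * \prod_(y <- Zroots f) (x - y).
Proof.
rewrite Zroots_factor hornerZ horner_prod; congr (_ * _).
by apply: eq_bigr => y _; rewrite hornerXsubC.
Qed.

(** This makes the factorisation over [L] available at [X] as well as at the [z i]. *)
Lemma iota_horner f : iota (FracField.tofrac f) = (map_poly cst f).[X].
Proof.
elim/poly_ind: f => [|f c IHf]; first by rewrite !rmorph0 horner0.
by rewrite !rmorphD !rmorphM /= map_polyX map_polyC /= hornerMXaddC IHf.
Qed.

Lemma val_horner (x : L) f : Lim x -> f != 0 ->
  exists (i0 : I) (b : G), forall i, (i0 < i)%O ->
    w (cst f.[z i]) = Some (b + gval i *+ count_lim f) /\
    vle (w (cst f.[z i])) (w (map_poly cst f).[x]).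
Proof.
move=> xlim f0; have [i0 [b fb]] := val_prod_factors (Zroots f) xlim.
have [|c wc] := @val_neq0 _ _ _ hw (cst (lead_coef f)).
  by rewrite fmorph_eq0 lead_coef_eq0.
exists i0, (c + b) => i /fb[ws les].
rewrite -[cst f.[_]]horner_map !horner_factor !(valuationM hw) wc.
by split; [rewrite ws /= addrA | apply: vle_add les => /=].
Qed.

Lemma val_horner_affine (x : L) f : Lim x -> f != 0 ->
  eventually_affine (fun i => w (cst f.[z i])) (count_lim f).
Proof.
move=> xlim f0; have [i0 [b fb]] := val_horner xlim f0.
by exists i0, b => i /fb[].
Qed.

(** * The relative approximation degree *)

Lemma count_lim_gt0 f y : y \in Zroots f -> Lim y -> (0 < count_lim f)%N.
Proof.
move=> yf ylim; rewrite -has_count; apply/hasP; exists y => //=.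
exact/asboolP.
Qed.

Lemma approx_degreeE f : Lim X -> f != 0 -> (0 < count_lim f)%N ->
  approx_degree iota w z f = count_lim f.
Proof.
move=> xlim f0 cf; have [i0 [b fb]] := val_horner xlim f0.
have wX i : w (X - cst (z i)) = Some (gval i) by move/LimE: xlim.
have wfX i : (i0 < i)%O -> w (iota (FracField.tofrac f) - cst f.[z i]) =
    Some (b + gval i *+ count_lim f).
  (* A later index [j] makes the comparison strict: the value at [z i] is below that at [z j], which
     is at most that at [X]. *)
  move=> i0i; have [j ij] := ord_succ i; have [wi _] := fb _ i0i.
  have [wj lej] := fb _ (lt_trans i0i ij).
  rewrite (valBC hG hw) -wi (valD_lt hG hw) // (valN hG hw) iota_horner.
  rewrite /vlt; apply/negP => /(vle_trans lej); apply/negP.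
  by rewrite -/(vlt _ _) wi wj vlt_SomeE //; exact/og_ltD2l/og_ltMn/cf/gval_lt.
apply: xget_unique => [|h [_ [i1 [c [_ fc]]]]].
  split=> //; exists i0, b; split; last by move=> i /wfX ->; rewrite wX.
  have [i i0i] := ord_succ i0; have [wi _] := fb _ i0i.
  (* To see that [b] lies in the value group of [K], the surplus [gval i *+ count_lim f] is divided
     out by a power of [u], an element of [K] with value [gval i]. *)
  set u := z (osucc i) - z i.
  have wu : w (cst u) = Some (gval i).
    by rewrite rmorphB val_pc //; case: (osuccP i).
  have un0 : cst u ^+ count_lim f != 0.
    rewrite expf_eq0 cf; apply/eqP => u0.
    by move/(valuation_eqoo hw): u0; rewrite wu.
  exists (f.[z i] / u ^+ count_lim f).
  have:= valuationM hw (cst (f.[z i] / u ^+ count_lim f)) (cst u ^+ count_lim f).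
  rewrite -rmorphXn -rmorphM /= divfK -?(fmorph_eq0 cst) ?rmorphXn // wi.
  rewrite /= (valX hw _ wu); case: (w _) => //= e [] /addIr ->.
  by [].
(* Since [w (X - cst (z i))] is [gval i], any other approximation degree is an exponent of the same
   sequence. *)
apply: eventually_affine_inj (_ : eventually_affine
  (fun i => w (iota (FracField.tofrac f) - cst f.[z i])) _) _.
  by exists i1, c => i i1i; rewrite fc // wX.
by exists i0, b.
Qed.

(** * Limits as a ball around [a], and the j-invariant *)

Lemma Lim_ge_gamma a y : Lim a -> Lim y <-> ge_gamma iota w z (w (a - y)).
Proof.
move=> /LimE alim; split=> [/LimE ylim i|ge_a].
  rewrite gamE; have:= valuationD hw (a - cst (z i)) (cst (z i) - y).
  by rewrite addrA subrK (valBC hG hw (cst _)) alim ylim /vmin /= lexx.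
(* Subtracting [a - y] from [a - cst (z i)] leaves its value unchanged: [w (a - y)] is at least
   [gam j] for some [j] after [i], hence strictly above [gam i]. *)
apply/LimE => i; rewrite -[y](subKr a) addrAC (valD_lt hG hw) // (valN hG hw).
rewrite alim; have [j ij] := ord_succ i; rewrite /vlt; apply/negP.
move=> /(vle_trans (ge_a j)); rewrite gamE; apply/negP.
by rewrite -/(vlt _ _) vlt_SomeE // gval_lt.
Qed.

Lemma count_lim_j_invariant a f : Lim a ->
  count_lim f = j_invariant iota w z a f.
Proof.
by move=> alim; apply: eq_count => y; apply/asbool_equiv_eq/Lim_ge_gamma.
Qed.

(** * Divisibility by the number of limit roots of [Q] *)

Lemma count_lim_ultimately_constant (x : L) f : Lim x -> f != 0 ->
  ultimately_constant iota w z f -> count_lim f = 0%N.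
Proof.
move=> xlim f0 [i0 [c fc]]; have fb := val_horner_affine xlim f0.
apply: eventually_affine_inj (fb) _; have [i1 [b {}fb]] := fb.
(* One late index identifies the constant [c] with a finite value, so the sequence also has exponent
   0. *)
have [j] := ord_succ (Order.max i0 i1); rewrite gt_max => /andP[i0j i1j].
exists i0, (b + gval j *+ count_lim f) => i i0i.
by rewrite mulr0n addr0 -fb // !fc.
Qed.

(** Uniqueness of the exponent replaces any comparison of the chosen root lists of [f], [g] and
    [f * g]. *)
Lemma count_limM (x : L) f g : Lim x -> f != 0 -> g != 0 ->
  count_lim (f * g) = (count_lim f + count_lim g)%N.
Proof.
move=> xlim f0 g0.
apply: eventually_affine_inj (val_horner_affine xlim (mulf_neq0 f0 g0)) _.
have [i0 [b fgb]] := eventually_affineD (val_horner_affine xlim f0)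
                                       (val_horner_affine xlim g0).
exists i0, b => i i0i.
by rewrite hornerM rmorphM /= (valuationM hw) fgb.
Qed.

Lemma dvdn_count_lim (x : L) (Q f : {poly K}) :
  Lim x -> minimal_polynomial iota w z Q -> (0 < count_lim Q)%N -> f != 0 ->
  (count_lim Q %| count_lim f)%N.
Proof.
move=> xlim [Qmonic Qnc Qmin] cQ; have Q0 := monic_neq0 Qmonic.
(* A constant polynomial has constant values; with [Q] nonconstant, the quotient is strictly smaller
   than [f] and the induction applies to it. *)
have Qsz : (1 < size Q)%N.
  rewrite ltnNge; apply/negP => /size1_polyC QC; apply: Qnc.
  by have [i _] := ord_inh; exists i, (w (cst Q`_0)) => k _; rewrite {1}QC hornerC.
have uc (r : {poly K}) : (size r < size Q)%N -> ultimately_constant iota w z r.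
  by move=> szr; apply: contrapT => /Qmin; rewrite leqNgt szr.
have [n] := ubnP (size f); elim: n f => // n IHn f szf f0.
have fE := divp_eq f Q; have szr : (size (f %% Q)%R < size Q)%N by rewrite ltn_modp.
have [q0|q0] := eqVneq (f %/ Q) 0.
  rewrite q0 mul0r add0r in fE.
  by rewrite (@count_lim_ultimately_constant x f) ?dvdn0 // fE; exact: uc.
have dq : (count_lim Q %| count_lim (f %/ Q * Q)%R)%N.
  rewrite (@count_limM x) // dvdn_addl // IHn // size_divp //.
  rewrite -ltnS; apply: leq_trans szf; rewrite ltnS ltn_subrL.
  by rewrite -subn1 subn_gt0 Qsz lt0n size_poly_eq0.
have [r0|r0] := eqVneq (f %% Q) 0; first by rewrite fE r0 addr0.
have cr := count_lim_ultimately_constant xlim r0 (uc _ szr).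
have qQ0 : f %/ Q * Q != 0 by exact: mulf_neq0.
(* The remainder has exponent 0, so positivity separates the two exponents, as needed to evaluate
   the sum. *)
have cpos : (0 < count_lim (f %/ Q * Q)%R)%N.
  by rewrite (@count_limM x) // addn_gt0 cQ orbT.
have rA := val_horner_affine xlim r0; rewrite cr in rA.
have := eventually_affine_sum cpos rA (val_horner_affine xlim qQ0).
have fA := val_horner_affine xlim f0.
have E m : eventually_affine
   (fun i => w (cst (f %% Q).[z i] + cst (f %/ Q * Q).[z i])) m -> count_lim f = m.
  move=> [i0 [b h]]; apply: eventually_affine_inj fA _; exists i0, b => i /h <-.
  by rewrite [in LHS]fE hornerD rmorphD addrC.
by case=> /E ->.
Qed.

End Theorem3p1.

Theorem theorem3p1 (p : nat) (K : fieldType) (L : closedFieldType)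
    (G : porderZmodType) (iota : {rmorphism {fraction {poly K}} -> L})
    (w : L -> option G) (d : Order.disp_t) (I : orderType d) (z : I -> K)
    (Q : {poly K}) (a : L) (f : {poly K})
    (hp : p \in [pchar K]) (p_odd : odd p)
    (hL : forall y : L, algebraicOver iota y)
    (hG : ordered_group G) (hw : is_valuation w)
    (himm : immediate iota w)
    (hI : limit_ordinal I)
    (hpc : pseudo_convergent iota w z)
    (hlimK : ~ exists c : K, Lim iota w z (cst iota c))
    (hlimX : Lim iota w z (xvar iota))
    (halg : algebraic_type iota w z)
    (hQ : minimal_polynomial iota w z Q)
    (ha : a \in Zroots iota Q) (halim : Lim iota w z a)
    (f0 : f != 0)
    (hf : exists2 y : L, y \in Zroots iota f & Lim iota w z y) :
  [/\ approx_degree iota w z f = count_lim iota w z f,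
      count_lim iota w z f = j_invariant iota w z a f
    & (approx_degree iota w z Q %| approx_degree iota w z f)%N].
Proof.
have Q0 : Q != 0 by case: hQ => /monic_neq0.
have [y yf ylim] := hf.
have cf : (0 < count_lim iota w z f)%N by exact: count_lim_gt0 ylim.
have cQ : (0 < count_lim iota w z Q)%N by exact: count_lim_gt0 halim.
split; first exact: approx_degreeE.
  exact: count_lim_j_invariant.
by rewrite !approx_degreeE //; exact: dvdn_count_lim hlimX hQ cQ f0.
Qed.
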